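(* Let $R$ be a unital $*$-ring and let $a,b\in R$ be core invertible such that $ab$ is also core invertible. If $a^*b=a^*a\,(ab)^{(\#)}b^2$ and $b^{(\#)}ba=ab\,b^{(\#)}$, then $(ab)^{(\#)}=a^{(\#)}b^{(\#)}$.
   Context: A unital $*$-ring is an associative ring $R$ with unity $1$ equipped with an involution $*:R\to R$ satisfying $(a+b)^*=a^*+b^*$, $(ab)^*=b^*a^*$ and $(a^* )^*=a$ for all $a,b\in R$. An element $a\in R$ is core invertible if there exists $x\in R$ with $axa=a$, $xax=x$, $(ax)^*=ax$, $xa^2=a$ and $ax^2=x$; such an $x$ is unique when it exists, is called the core inverse of $a$, and is denoted $a^{(\#)}$. *)

(* Defs.v *)
From HB Require Import structures.
From mathcomp Require Import all_boot all_algebra.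

Set Implicit Arguments.
Unset Strict Implicit.
Unset Printing Implicit Defensive.

Import GRing.Theory.
Local Open Scope ring_scope.

(* The base structure is pzRingType, so that the zero ring is not excluded. *)
HB.mixin Record PzRing_isStarRing R of GRing.PzRing R := {
  star : R -> R;
  starD : forall a b : R, star (a + b) = star a + star b;
  starM : forall a b : R, star (a * b) = star b * star a;
  starK : forall a : R, star (star a) = a
}.

#[short(type="starRingType")]
HB.structure Definition StarRing :=
  { R of PzRing_isStarRing R & GRing.PzRing R }.

Record is_core_inverse (R : starRingType) (a x : R) : Prop := IsCoreInverse {
  core_inv_inner : a * x * a = a;
  core_inv_outer : x * a * x = x;
  core_inv_star : star (a * x) = a * x;
  core_inv_mulsq : x * a ^+ 2 = a;
  core_inv_sqmul : a * x ^+ 2 = x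
}.

Lemma is_core_inverse_unique (R : starRingType) (a x y : R) :
  is_core_inverse a x -> is_core_inverse a y -> x = y.
Proof.
move=> [axa xax sax xa2 ax2] [aya yay say ya2 ay2].
have axay : a * x = a * y.
  by rewrite -sax -{1}aya -!mulrA mulrA starM sax say !mulrA axa.
by rewrite -xax -mulrA axay -{1}ay2 expr2 !mulrA -(mulrA x a a) -expr2 xa2
           -mulrA -expr2 ay2.
Qed.

(* Main.v *)
Require Import Defs.
From mathcomp Require Import all_boot all_algebra.

(** Write [q = b b'] for the orthogonal projection onto the right ideal [bR],
    and [x] for the core inverse of [c = ab].

    The hypothesis on [star a * b] is an equation for [a'b']: cancelling
    [star a] turns it into [(a a') b = a x b^2]; multiplying by [a'] on the left
    and by [b'^2] on the right gives [a'b' = a'a x q].  Two absorption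
    properties then finish the proof.
    - [a'a x = x], because [x] lies in [cR], hence in [aR], and [a'a] fixes
      [aR].
    - [x q = x], where the commutation hypothesis enters.  Since [b'b] and [q]
      are idempotents with the same range [bR], the relation [b'b a = a q] shows
      that [a] maps [bR] into [bR]; hence [q c = c].  The projection [c x] is
      self-adjoint, so [q c x = c x] is equivalent to [c x q = c x];
      now multiply by [x] on the left. *)

Import GRing.Theory.
Local Open Scope ring_scope.

Section CoreInverse.

Variables (R : starRingType) (a x : R).
Hypothesis ax_core : is_core_inverse a x.

(** Taking adjoints moves [q] across the self-adjoint projection [a x]. *)
Lemma core_inv_absorb_r (q : R) : star q = q -> q * a = a -> x * q = x.
Proof.
case: ax_core => [_ xax sax _ _] sq qa.
have axq : a * x * q = a * x by rewrite -sax -[in LHS]sq -starM mulrA qa.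
by rewrite -{1}xax -!mulrA (mulrA a) axq mulrA.
Qed.

(** [x = a x^2] lies in the right ideal [aR], so what fixes [a] on the left also
    fixes [x]. *)
Lemma core_inv_absorb_l (e : R) : e * a = a -> e * x = x.
Proof. by case: ax_core => [_ _ _ _ <-] ea; rewrite mulrA ea. Qed.

(** [star x] undoes [star a] up to the projection [a x], and [a x] fixes [a]:
    this is how a left factor [star a * a] is cancelled. *)
Lemma core_inv_star_cancel (u v : R) :
  star a * u = star a * a * v -> a * x * u = a * v.
Proof.
case: ax_core => [axa _ sax _ _] /(congr1 ( *%R (star x))).
by rewrite !mulrA -starM sax axa.
Qed.

End CoreInverse.

(** [b'b] and [b b'] have the same range [bR], so the commutation relation makes
    [bR] invariant under [a]. *)
Lemma core_inv_range_invariant (R : starRingType) (a b b' : R) :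
  is_core_inverse b b' -> b' * b * a = a * b * b' ->
  b * b' * (a * b) = a * b.
Proof.
case=> [bb'b _ _ _ bb'2] comm.
have ab_fixed : b' * b * (a * b) = a * b.
  by rewrite mulrA comm -!mulrA (mulrA b) bb'b.
have qe : b * b' * (b' * b) = b' * b.
  by rewrite mulrA -(mulrA b) -expr2 bb'2.
by rewrite -ab_fixed mulrA qe.
Qed.

Theorem theorem3p3 (R : starRingType) (a b a' b' ab' : R)
    (ha : is_core_inverse a a') (hb : is_core_inverse b b')
    (hab : is_core_inverse (a * b) ab')
    (h1 : star a * b = star a * a * ab' * b ^+ 2)
    (h2 : b' * b * a = a * b * b') :
  ab' = a' * b'.
Proof.
have xq : ab' * (b * b') = ab'.
  apply: (core_inv_absorb_r _ _ _ hab); first exact: core_inv_star hb.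
  exact: core_inv_range_invariant hb h2.
have ea_x : a' * a * ab' = ab'.
  apply: (core_inv_absorb_l _ _ _ hab).
  by rewrite mulrA -(mulrA a') -expr2 (core_inv_mulsq ha).
have pb : a * a' * b = a * (ab' * b ^+ 2).
  by apply: (core_inv_star_cancel _ _ _ ha); rewrite h1 mulrA.
have pb' : a * a' * b' = a * ab'.
  rewrite -{1}(core_inv_sqmul hb) mulrA pb expr2 -!mulrA.
  by rewrite (core_inv_sqmul hb) xq.
by rewrite -(core_inv_outer ha) -!mulrA (mulrA a) pb' mulrA ea_x.
Qed.
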